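(* Let $f,f^\nu:\mathbb{R}^m\times\mathbb{R}^n\to\overline{\mathbb{R}}$ (with $\nu$ fixed) be Rockafellians (for functions $\phi,\phi^\nu:\mathbb{R}^n\to\overline{\mathbb{R}}$, respectively). Suppose that $\operatorname{epi} f$, $\operatorname{epi} f^\nu$, $\operatorname{dom}(-\psi)$, and $\operatorname{dom}(-\psi^\nu)$ are nonempty, and $\rho\in[0,\infty)$. Let $\|\cdot\|_2$, $(u,x)\mapsto\max\{\|u\|_2,\|x\|_2\}$, $(y,\alpha)\mapsto\max\{\|y\|_2,|\alpha|\}$, and $(u,x,\alpha)\mapsto\max\{\|u\|_2,\|x\|_2,|\alpha|\}$ be the norms on $\mathbb{R}^m$, $\mathbb{R}^m\times\mathbb{R}^n$, $\mathbb{R}^m\times\mathbb{R}$, and $\mathbb{R}^m\times\mathbb{R}^n\times\mathbb{R}$, respectively. Then: (a) If $\hat\rho>\rho+\hat d_\rho(\operatorname{dom}(-\psi),\operatorname{dom}(-\psi^\nu))$ and $\rho'\in[1,\infty)$ satisfies $$\forall y\in\operatorname{dom}(-\psi)\cap\mathbb{B}(\hat\rho):\quad\operatorname{argmin} f_y\cap\mathbb{B}(\rho')\ne\emptyset,\quad\psi(y)\in[-\rho',\rho'],$$ $$\forall y^\nu\in\operatorname{dom}(-\psi^\nu)\cap\mathbb{B}(\hat\rho):\quad\operatorname{argmin} f^\nu_{y^\nu}\cap\mathbb{B}(\rho')\ne\emptyset,\quad\psi^\nu(y^\nu)\in[-\rho',\rho'],$$ then, provided that $\bar\rho\ge\rho'(1+\hat\rho)$,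 one has $$\hat d_\rho(\operatorname{hypo}\psi^\nu,\operatorname{hypo}\psi)\le(1+\hat\rho)\,\hat d_{\bar\rho}(\operatorname{epi} f,\operatorname{epi} f^\nu)+\rho'\,\hat d_\rho\big(\operatorname{dom}(-\psi),\operatorname{dom}(-\psi^\nu)\big).$$ (b) If $Y(\rho)=\operatorname{dom}(-\psi)\cap\operatorname{dom}(-\psi^\nu)\cap\mathbb{B}(\rho)$ is nonempty and $\rho'\in[0,\infty)$ satisfies for all $y\in Y(\rho)$ $$\operatorname{argmin} f_y\cap\mathbb{B}(\rho')\ne\emptyset,\quad\operatorname{argmin} f^\nu_y\cap\mathbb{B}(\rho')\ne\emptyset,\quad\psi(y),\psi^\nu(y)\in[-\rho',\rho'],$$ then, provided that $\bar\rho\ge\rho'(1+\rho)$, one has $$\sup_{y\in Y(\rho)}|\psi(y)-\psi^\nu(y)|\le(1+\rho)\,\hat d_{\bar\rho}(\operatorname{epi} f,\operatorname{epi} f^\nu).$$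
   Context: $\overline{\mathbb{R}}=[-\infty,\infty]$. A function $f:\mathbb{R}^m\times\mathbb{R}^n\to\overline{\mathbb{R}}$ is a Rockafellian for $g:\mathbb{R}^n\to\overline{\mathbb{R}}$ when $f(0,x)=g(x)$ for all $x$. For $y\in\mathbb{R}^m$: $f_y(u,x)=f(u,x)-\langle y,u\rangle$, $f^\nu_y(u,x)=f^\nu(u,x)-\langle y,u\rangle$. Dual functions: $\psi(y)=\inf_{u,x}f_y(u,x)$, $\psi^\nu(y)=\inf_{u,x}f^\nu_y(u,x)$. For $g:\mathbb{R}^d\to\overline{\mathbb{R}}$: $\operatorname{dom} g=\{x\mid g(x)<\infty\}$, $\operatorname{epi} g=\{(x,\alpha)\in\mathbb{R}^d\times\mathbb{R}\mid g(x)\le\alpha\}$, $\operatorname{hypo} g=\{(x,\alpha)\in\mathbb{R}^d\times\mathbb{R}\mid g(x)\ge\alpha\}$, $\operatorname{argmin} g=\{x^\star\in\operatorname{dom} g\mid g(x^\star)\le\inf g\}$. Truncated Hausdorff distance: given a norm on the ambient space, $\mathbb{B}(\rho)=\{x\mid\|x\|\le\rho\}$; the excess is $\operatorname{exs}(C;D)=\sup_{x\in C}\inf_{y\in D}\|x-y\|$ if $C,D$ are nonempty, $\operatorname{exs}(C;\emptyset)=\infty$ if $C\ne\emptyset$, and $\operatorname{exs}(\emptyset;D)=0$ for every $D$; and $\hat d_\rho(C,D)=\max\{\operatorname{exs}(C\cap\mathbb{B}(\rho);D),\ \operatorname{exs}(D\cap\mathbb{B}(\rho);C)\}$ for $\rho\ge0$.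 *)

(* Defs.v *)
From HB Require Import structures.
From mathcomp Require Import all_boot all_order all_algebra.
From mathcomp Require Import all_classical all_reals all_analysis.

Set Implicit Arguments.
Unset Strict Implicit.
Unset Printing Implicit Defensive.

Import Order.TTheory GRing.Theory Num.Theory.

Local Open Scope classical_set_scope.
Local Open Scope ring_scope.
Local Open Scope ereal_scope.

Definition edom (R : realType) (T : Type) (g : T -> \bar R) : set T :=
  [set x | g x < +oo].

Definition epi (R : realType) (T : Type) (g : T -> \bar R) : set (T * R) :=
  [set p | g p.1 <= p.2%:E].

Definition hypo (R : realType) (T : Type) (g : T -> \bar R) : set (T * R) :=
  [set p | p.2%:E <= g p.1].

Definition argmin (R : realType) (T : Type) (g : T -> \bar R) : set T :=
  [set x | edom g x /\ g x <= ereal_inf (range g)].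

(* The norm on row vectors provided by the library is the max-norm, hence the
   explicit Euclidean norm.  Norms are passed around as plain functions, since
   several ambient product spaces carry a norm built from it. *)
Definition norm2 (R : realType) (d : nat) (x : 'rV[R]_d) : R :=
  Num.sqrt (\sum_(i < d) x ord0 i ^+ 2)%R.

Definition dotprod (R : realType) (d : nat) (x y : 'rV[R]_d) : R :=
  (\sum_(i < d) x ord0 i * y ord0 i)%R.

Definition maxnorm (R : realType) (V W : Type) (N : V -> R) (M : W -> R)
    (p : V * W) : R :=
  Num.max (N p.1) (M p.2).

Definition nball (R : realType) (V : Type) (N : V -> R) (rho : R) : set V :=
  [set x | (N x <= rho)%R].

(* The empty cases are explicit: in particular, the excess of the empty set is
   0, whereas the supremum of the empty set in \bar R is -oo. *)
Definition excess (R : realType) (V : zmodType) (N : V -> R) (C D : set V) :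
    \bar R :=
  if C == set0 then 0
  else if D == set0 then +oo
  else ereal_sup [set ereal_inf [set (N (x - y)%R)%:E | y in D] | x in C].

Definition dhat (R : realType) (V : zmodType) (N : V -> R) (rho : R)
    (C D : set V) : \bar R :=
  Order.max (excess N (C `&` nball N rho) D) (excess N (D `&` nball N rho) C).

Definition rockafellian (R : realType) (m n : nat)
    (f : 'rV[R]_m * 'rV[R]_n -> \bar R) (g : 'rV[R]_n -> \bar R) : Prop :=
  forall x, f (0%R, x) = g x.

Definition tilt (R : realType) (m n : nat)
    (f : 'rV[R]_m * 'rV[R]_n -> \bar R) (y : 'rV[R]_m)
    (p : 'rV[R]_m * 'rV[R]_n) : \bar R :=
  f p - (dotprod y p.1)%:E.

Definition dual (R : realType) (m n : nat)
    (f : 'rV[R]_m * 'rV[R]_n -> \bar R) (y : 'rV[R]_m) : \bar R :=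
  ereal_inf (range (tilt f y)).

Definition normUX (R : realType) (m n : nat) : 'rV[R]_m * 'rV[R]_n -> R :=
  maxnorm (@norm2 R m) (@norm2 R n).

Definition normYA (R : realType) (m : nat) : 'rV[R]_m * R -> R :=
  maxnorm (@norm2 R m) (fun a : R => `|a|%R).

Definition normUXA (R : realType) (m n : nat) :
    'rV[R]_m * 'rV[R]_n * R -> R :=
  maxnorm (@normUX R m n) (fun a : R => `|a|%R).

(* Main.v *)
(* Let {f, g} = {f, f^nu} and let (u, x) minimize the tilted function g_z.
   Then (u, x, g(u, x)) lies in epi g and, by Cauchy-Schwarz, in the ball of
   radius rhobar, so some point (u', x', a') of epi f is within the excess
   delta of it. The value a' - <y, u'> bounds the dual function of f at y by
   that of g at z, up to (1 + r) delta + rho' |y - z|. Part (b) is the case y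
   = z, used twice. In part (a), a point (y, alpha) of the first hypograph is
   approximated by (z, min(alpha, psi_g(z))), where z is a nearby point of
   the other domain. *)
Require Import Defs.
From HB Require Import structures.
From mathcomp Require Import all_boot all_order all_algebra.
From mathcomp Require Import all_classical all_reals all_analysis.
From mathcomp Require Import ring lra.

Set Implicit Arguments.
Unset Strict Implicit.
Unset Printing Implicit Defensive.

Import Order.TTheory GRing.Theory Num.Theory.

Local Open Scope classical_set_scope.
Local Open Scope ring_scope.
Local Open Scope ereal_scope.

(** * Euclidean norm and inner product *)

Lemma norm2_ge0 (R : realType) (d : nat) (x : 'rV[R]_d) : (0 <= norm2 x)%R.
Proof. exact: sqrtr_ge0. Qed.

Lemma sqr_norm2 (R : realType) (d : nat) (x : 'rV[R]_d) :
  (norm2 x ^+ 2 = dotprod x x)%R.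
Proof.
rewrite sqr_sqrtr; last by apply: sumr_ge0 => i _; rewrite sqr_ge0.
by apply: eq_bigr => i _; rewrite expr2.
Qed.

Lemma dotprodC (R : realType) (d : nat) (x y : 'rV[R]_d) :
  dotprod x y = dotprod y x.
Proof. by apply: eq_bigr => i _; rewrite mulrC. Qed.

Lemma dotprodBl (R : realType) (d : nat) (x y z : 'rV[R]_d) :
  (dotprod (x - y) z = dotprod x z - dotprod y z)%R.
Proof.
by rewrite -sumrB; apply: eq_bigr => i _; rewrite !mxE mulrBl.
Qed.

Lemma dotprodBr (R : realType) (d : nat) (x y z : 'rV[R]_d) :
  (dotprod z (x - y) = dotprod z x - dotprod z y)%R.
Proof. by rewrite !(dotprodC z) dotprodBl. Qed.

Lemma dotprodZl (R : realType) (d : nat) (a : R) (x y : 'rV[R]_d) :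
  (dotprod (a *: x) y = a * dotprod x y)%R.
Proof.
by rewrite /dotprod mulr_sumr; apply: eq_bigr => i _; rewrite mxE mulrA.
Qed.

(** Cauchy-Schwarz. For [y] nonzero, expand [0 <= dotprod v v] at v = <y,y> x - <x,y> y and cancel
    the factor <y,y>; for <y,y> = 0 every coordinate of [y] vanishes. *)
Lemma dotprod_le_norm2 (R : realType) (d : nat) (x y : 'rV[R]_d) :
  (`|dotprod x y| <= norm2 x * norm2 y)%R.
Proof.
rewrite -ler_sqr ?nnegrE ?mulr_ge0 ?norm2_ge0// real_normK ?num_real//.
rewrite exprMn !sqr_norm2.
have sqr_norm (z : 'rV[R]_d) : (0 <= dotprod z z)%R by rewrite -sqr_norm2 sqr_ge0.
have := sqr_norm y; rewrite le0r => /orP[/eqP y0|y_gt0]; last first.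
  rewrite -(ler_pM2l y_gt0).
  have := sqr_norm (dotprod y y *: x - dotprod x y *: y)%R.
  rewrite !dotprodBl !dotprodBr !dotprodZl !(dotprodC _ (_ *: _)%R) !dotprodZl.
  by rewrite (dotprodC y x); nra.
have yi i : y ord0 i = 0%R.
  apply/eqP; rewrite -sqrf_eq0; apply/eqP.
  have /psumr_eq0P := y0; rewrite expr2; apply=> // j _.
  by rewrite -expr2 sqr_ge0.
rewrite y0 mulr0 /dotprod big1 ?expr0n// => i _.
by rewrite yi mulr0.
Qed.

Lemma norm2_triangle (R : realType) (d : nat) (x y : 'rV[R]_d) :
  (norm2 (x - y) <= norm2 x + norm2 y)%R.
Proof.
rewrite -ler_sqr ?nnegrE ?addr_ge0 ?norm2_ge0//.
rewrite sqrrD !sqr_norm2 dotprodBl !dotprodBr (dotprodC y x).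
have := dotprod_le_norm2 x y; rewrite ler_norml => /andP[].
by rewrite -!sqr_norm2; lra.
Qed.

Lemma maxnorm_ge0 (R : realType) (V W : Type) (N : V -> R) (M : W -> R)
    (p : V * W) : (0 <= N p.1)%R -> (0 <= maxnorm N M p)%R.
Proof. by move=> N0; rewrite le_max N0. Qed.

(** * Excess and truncated Hausdorff distance *)

Section Excess.
Variables (R : realType) (V : zmodType) (N : V -> R).
Implicit Types C D : set V.

Lemma excess_ge0 C D : (forall x, (0 <= N x)%R) -> 0 <= excess N C D.
Proof.
move=> N0; rewrite /excess; case: eqP => // /eqP/set0P[x Cx].
case: eqP => // _; apply: le_ereal_sup_tmp.
eexists; first by exists x.
by apply/ereal_infP => _ [y _ <-]; rewrite lee_fin.
Qed.

Lemma excess_le C D (e : R) : (0 <= e)%R ->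
  (forall x, C x -> exists2 y, D y & (N (x - y) <= e)%R) ->
  excess N C D <= e%:E.
Proof.
move=> e0 CD; rewrite /excess; case: eqP => [_|/eqP/set0P[x0 Cx0]].
  by rewrite lee_fin.
case: eqP => [D0|_]; first by have [y] := CD _ Cx0; rewrite D0.
apply/ereal_supP => _ [x Cx <-]; have [y Dy Ny] := CD _ Cx.
by apply: ge_ereal_inf; exists (N (x - y))%:E; [exists y|rewrite lee_fin].
Qed.

(** The strict bound makes up for an infimum over [D] that need not be attained; this is why a slack
    [t] is added to each excess below. *)
Lemma excess_lt C D (e : R) (x : V) : excess N C D < e%:E -> C x ->
  exists2 y, D y & (N (x - y) < e)%R.
Proof.
rewrite /excess => + Cx; case: eqP => [C0|_]; first by rewrite C0 in Cx.
case: eqP => [_|_]; first by rewrite ltNge leey.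
move=> sup_lt; suff /ereal_inf_lt[_ [y Dy <-]] :
  ereal_inf [set (N (x - y)%R)%:E | y in D] < e%:E.
  by rewrite lte_fin; exists y.
by apply: le_lt_trans sup_lt; apply: ereal_sup_ubound; exists x.
Qed.

Lemma dhat_ge0 (rho : R) C D : (forall x, (0 <= N x)%R) -> 0 <= dhat N rho C D.
Proof. by move=> N0; rewrite le_max excess_ge0. Qed.

End Excess.

(* The error bound comes from <z, u> - <y, u'> = <z - y, u> + <y, u - u'>. *)
Lemma dual_perturbation (R : realType) (m n : nat)
    (f g : 'rV[R]_m * 'rV[R]_n -> \bar R) (y z : 'rV[R]_m)
    (r rho' rhobar delta : R) :
  (norm2 y <= r)%R -> (norm2 z <= r)%R ->
  argmin (tilt g z) `&` nball (@normUX R m n) rho' !=set0 ->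
  (- rho')%:E <= dual g z <= rho'%:E ->
  (rho' * (1 + r) <= rhobar)%R ->
  excess (@normUXA R m n) (epi g `&` nball (@normUXA R m n) rhobar) (epi f)
    < delta%:E ->
  dual f y <= dual g z + ((1 + r) * delta + rho' * norm2 (y - z))%:E.
Proof.
move=> yr zr [[u x] [[_ gmin]]].
rewrite /nball/= /normUX /maxnorm/= ge_max => /andP[urho xrho] gbnd rhobarP exs.
have : dual g z = tilt g z (u, x).
  apply/le_anti; rewrite gmin andbT.
  by apply: ereal_inf_lbound; exists (u, x).
(* The bounds on the dual value make it a real [b], and then g(u, x) is a real [a] with b = a - <z,
   u>. *)
case: (dual g z) gbnd => [b| |]; last 2 first.
- by rewrite andbC leNgt ltey.
- by rewrite leNgt ltNye.
rewrite !lee_fin => /andP[b_lo b_hi]; rewrite /tilt.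
case guxE : (g (u, x)) => [a| |] // -[bE].
have rho'_ge0 : (0 <= rho')%R by rewrite (le_trans (norm2_ge0 u)).
have r_ge0 : (0 <= r)%R by rewrite (le_trans (norm2_ge0 y)).
have rho'_le : (rho' <= rhobar)%R by nra.
(* Source of the threshold on [rhobar]: |a| = |b + <z, u>| <= rho' + rho' r. *)
have zu : (`|dotprod z u| <= rho' * r)%R.
  rewrite (le_trans (dotprod_le_norm2 _ _))// mulrC.
  by rewrite ler_pM ?norm2_ge0.
have inball : (epi g `&` nball (@normUXA R m n) rhobar) (u, x, a).
  split; first by rewrite /epi/= guxE.
  rewrite /nball/= /normUXA /normUX /maxnorm/= !ge_max.
  rewrite (le_trans urho)// (le_trans xrho)//=.
  by move: zu; rewrite !ler_norml => /andP[? ?]; apply/andP; split; nra.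
have [[[u' x'] a'] fa'] := excess_lt exs inball.
rewrite /normUXA /normUX /maxnorm/= !gt_max => /andP[/andP[uu' _] aa'].
apply: ge_ereal_inf; exists (tilt f y (u', x')); first by exists (u', x').
apply: (@le_trans _ _ (a' - dotprod y u')%:E).
  by rewrite EFinB leeD2r.
rewrite -EFinD lee_fin.
(* Three errors add up: [delta] from a' - a, [r * delta] from <y, u - u'>, and
   [rho' * norm2 (y - z)] from <y - z, u>. *)
have : (`|dotprod y (u - u')| <= r * delta)%R.
  rewrite (le_trans (dotprod_le_norm2 _ _))//.
  by rewrite ler_pM ?norm2_ge0// ltW.
have : (`|dotprod (y - z) u| <= rho' * norm2 (y - z))%R.
  rewrite (le_trans (dotprod_le_norm2 _ _))// mulrC.
  by rewrite ler_wpM2r ?norm2_ge0.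
move: aa'; rewrite dotprodBl dotprodBr bE ltr_norml !ler_norml.
by move=> /andP[? ?] /andP[? ?] /andP[? ?]; nra.
Qed.

(** One half of part (a). Only upper bounds [dE] and [dD] on one-sided excesses enter, so the other
    half follows by exchanging [f] and [g]. *)
Lemma excess_hypo_dual (R : realType) (m n : nat)
    (f g : 'rV[R]_m * 'rV[R]_n -> \bar R) (rho rhohat rho' rhobar : R)
    (dE dD : \bar R) :
  (0 <= rho)%R -> 0 <= dE -> 0 <= dD -> rho%:E + dD < rhohat%:E ->
  (1 <= rho')%R -> (rho' * (1 + rhohat) <= rhobar)%R ->
  let Df := edom (fun y => - dual f y) in
  let Dg := edom (fun y => - dual g y) in
  (forall y, (Dg `&` nball (@norm2 R m) rhohat) y ->
     argmin (tilt g y) `&` nball (@normUX R m n) rho' !=set0 /\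
     (- rho')%:E <= dual g y <= rho'%:E) ->
  excess (@norm2 R m) (Df `&` nball (@norm2 R m) rho) Dg <= dD ->
  excess (@normUXA R m n) (epi g `&` nball (@normUXA R m n) rhobar) (epi f)
    <= dE ->
  excess (@normYA R m) (hypo (dual f) `&` nball (@normYA R m) rho)
    (hypo (dual g)) <= (1 + rhohat)%:E * dE + rho'%:E * dD.
Proof.
move=> rho_ge0 dE0 dD0 rhohatP rho'1 rhobarP Df Dg gP excD excE.
case: dD dD0 rhohatP excD => [b| |]; [|by rewrite addey|by rewrite leNgt ltNyr].
rewrite -EFinD !lee_fin lte_fin => b0 rhohatP excD.
case: dE dE0 excE => [a| |]; last 2 first.
- by move=> _ _; rewrite gt0_muley ?addye ?leey// lte_fin; lra.
- by rewrite leNgt ltNyr.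
rewrite lee_fin => a0 excE; rewrite -!EFinM -EFinD.
apply/lee_addgt0Pr => e e0; rewrite -EFinD.
(* The first term keeps the total cost of the slack below [e]; the second keeps [z] in the ball of
   radius [rhohat], by the triangle inequality. It is positive because [rho + b < rhohat]. *)
pose t := Num.min (e / (1 + rhohat + rho'))%R (rhohat - rho - b)%R.
have c0 : (0 < 1 + rhohat + rho')%R by lra.
have t0 : (0 < t)%R by rewrite lt_min divr_gt0//=; lra.
have te : ((1 + rhohat + rho') * t <= e)%R.
  by rewrite mulrC -ler_pdivlMr// ge_min lexx.
have tb : (rho + (b + t) <= rhohat)%R.
  suff : (t <= rhohat - rho - b)%R by lra.
  by rewrite ge_min lexx orbT.
apply: excess_le => [|[y al]]; first by nra.
rewrite /hypo /nball/= /normYA /maxnorm/= ge_max => -[aly /andP[yrho _]].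
(* A real [al] below the dual value excludes -oo. *)
have Dfy : (Df `&` nball (@norm2 R m) rho) y.
  split=> //; rewrite /Df /edom/=.
  by case: (dual f y) aly => [s| |]//= _; rewrite ltey.
have excD' : excess (@norm2 R m) (Df `&` nball (@norm2 R m) rho) Dg
    < (b + t)%:E by apply: le_lt_trans excD _; rewrite lte_fin; lra.
have excE' : excess (@normUXA R m n)
    (epi g `&` nball (@normUXA R m n) rhobar) (epi f)
    < (a + t)%:E by apply: le_lt_trans excE _; rewrite lte_fin; lra.
have [z Dgz yz] := excess_lt excD' Dfy.
have yhat : (norm2 y <= rhohat)%R by lra.
have zhat : (norm2 z <= rhohat)%R.
  have := norm2_triangle y (y - z); rewrite opprB addrC subrK.
  by lra.
have [gmin gbnd] := gP z (conj Dgz zhat).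
have := dual_perturbation yhat zhat gmin gbnd rhobarP excE'.
case gzE : (dual g z) gbnd => [s| |] gbnd; last 2 first.
- by rewrite andbC leNgt ltey in gbnd.
- by rewrite leNgt ltNye in gbnd.
move=> /(le_trans aly); rewrite -EFinD lee_fin => als.
have yzb : (rho' * norm2 (y - z) <= rho' * (b + t))%R.
  by rewrite ler_wpM2l//; lra.
(* The vertical gap is max(0, al - s), controlled by [als]. The horizontal gap is below b + t <=
   rho' (b + t); this uses [1 <= rho']. *)
exists (z, Num.min al s)%R; first by rewrite /= gzE lee_fin ge_min lexx orbT.
rewrite /= ge_max; apply/andP; split.
  have := norm2_ge0 (y - z); nra.
rewrite ger0_norm ?subr_ge0 ?ge_min ?lexx// lerBlDr -lerBlDl le_min.
by apply/andP; split; nra.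
Qed.

Theorem theorem5p2 (R : realType) (m n : nat)
    (f fnu : 'rV[R]_m * 'rV[R]_n -> \bar R) (phi phinu : 'rV[R]_n -> \bar R)
    (rho : R)
    (f_rock : rockafellian f phi) (fnu_rock : rockafellian fnu phinu)
    (epi_f : epi f !=set0) (epi_fnu : epi fnu !=set0)
    (dom_psi : edom (fun y => - dual f y) !=set0)
    (dom_psinu : edom (fun y => - dual fnu y) !=set0)
    (rho_ge0 : (0 <= rho)%R) :
  let psi := dual f in
  let psinu := dual fnu in
  let D := edom (fun y => - psi y) in
  let Dnu := edom (fun y => - psinu y) in
  (forall rhohat rho' rhobar : R,
     rho%:E + dhat (@norm2 R m) rho D Dnu < rhohat%:E ->
     (1 <= rho')%R ->
     (forall y, (D `&` nball (@norm2 R m) rhohat) y ->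
        argmin (tilt f y) `&` nball (@normUX R m n) rho' !=set0 /\
        (- rho')%:E <= psi y <= rho'%:E) ->
     (forall y, (Dnu `&` nball (@norm2 R m) rhohat) y ->
        argmin (tilt fnu y) `&` nball (@normUX R m n) rho' !=set0 /\
        (- rho')%:E <= psinu y <= rho'%:E) ->
     (rho' * (1 + rhohat) <= rhobar)%R ->
     dhat (@normYA R m) rho (hypo psinu) (hypo psi) <=
       (1 + rhohat)%:E * dhat (@normUXA R m n) rhobar (epi f) (epi fnu) +
       rho'%:E * dhat (@norm2 R m) rho D Dnu)
  /\
  (let Y := D `&` Dnu `&` nball (@norm2 R m) rho in
   forall rho' rhobar : R,
     Y !=set0 ->
     (0 <= rho')%R ->
     (forall y, Y y ->
        [/\ argmin (tilt f y) `&` nball (@normUX R m n) rho' !=set0,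
            argmin (tilt fnu y) `&` nball (@normUX R m n) rho' !=set0,
            (- rho')%:E <= psi y <= rho'%:E &
            (- rho')%:E <= psinu y <= rho'%:E]) ->
     (rho' * (1 + rho) <= rhobar)%R ->
     ereal_sup [set `|psi y - psinu y| | y in Y] <=
       (1 + rho)%:E * dhat (@normUXA R m n) rhobar (epi f) (epi fnu)).
Proof.
move=> psi psinu D Dnu.
have N2 (x : 'rV[R]_m) : (0 <= norm2 x)%R by exact: norm2_ge0.
have NUXA (p : 'rV[R]_m * 'rV[R]_n * R) : (0 <= normUXA p)%R.
  by do 2 apply: maxnorm_ge0; exact: norm2_ge0.
split=> [rhohat rho' rhobar rhohatP rho'1 fP fnuP rhobarP|].
  rewrite /dhat ge_max; apply/andP; split.
    (* Here [fnu] takes the place of [f] and [f] that of [g]; each one-sided excess is at most the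
       corresponding [dhat]. *)
    apply: (excess_hypo_dual _ _ _ rhohatP rho'1 rhobarP fP) => //;
      by rewrite ?dhat_ge0// le_max lexx ?orbT.
  apply: (excess_hypo_dual _ _ _ rhohatP rho'1 rhobarP fnuP) => //;
    by rewrite ?dhat_ge0// le_max lexx ?orbT.
move=> Y rho' rhobar _ rho'0 YP rhobarP.
apply/ereal_supP => _ [y Yy <-].
have [fmin fnumin psib psinub] := YP y Yy.
have yrho : (norm2 y <= rho)%R by case: Yy.
set dE := dhat _ _ _ _.
have : 0 <= dE by exact: dhat_ge0.
(* An infinite distance makes the right-hand side +oo, since 1 + rho > 0. *)
case dEE : dE => [a| |] a0; last 2 first.
- by rewrite gt0_muley ?leey// lte_fin; lra.
- by rewrite leNgt ltNyr in a0.
rewrite -EFinM; apply/lee_addgt0Pr => e e0; rewrite -EFinD.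
pose t := (e / (1 + rho))%R.
have rho1 : (0 < 1 + rho)%R by lra.
have t0 : (0 < t)%R by exact: divr_gt0.
have te : ((1 + rho) * t = e)%R by rewrite mulrC divfK// gt_eqF.
have : dE < (a + t)%:E by rewrite dEE lte_fin ltrDl.
rewrite gt_max => /andP[exf exfnu].
have := dual_perturbation yrho yrho fmin psib rhobarP exf.
have := dual_perturbation yrho yrho fnumin psinub rhobarP exfnu.
(* With z = y the [rho'] term vanishes, leaving the error (1 + rho) (a + t) = (1 + rho) a + e in
   both directions. *)
rewrite subrr /norm2 big1 ?sqrtr0 ?mulr0 ?addr0; last first.
  by move=> i _; rewrite mxE expr0n.
rewrite -/psi -/psinu.
case: (psi y) psib => [s| |]; [|by rewrite andbC leNgt ltey
                               |by rewrite leNgt ltNye].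
case: (psinu y) psinub => [s'| |]; [|by rewrite andbC leNgt ltey
                                     |by rewrite leNgt ltNye].
move=> _ _; rewrite -!EFinD !lee_fin => ss' s's.
by rewrite ler_norml; apply/andP; split; nra.
Qed.
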